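(* Let $(M,\phi,\xi,\eta,g)$ be a $(2n+1)$-dimensional para-Sasaki-like Riemannian manifold, with curvature tensor $R$ and Ricci tensor $Ric$. Then for all vector fields $x,y,z,w$ $$\begin{aligned}R(x,y,\phi z,w)-R(x,y,z,\phi w)=&-\{g(y,z)-2\eta(y)\eta(z)\}g(x,\phi w)-\{g(y,w)-2\eta(y)\eta(w)\}g(x,\phi z)\\&+\{g(x,z)-2\eta(x)\eta(z)\}g(y,\phi w)+\{g(x,w)-2\eta(x)\eta(w)\}g(y,\phi z).\end{aligned}$$ In particular, for all vector fields $x,y$ and all horizontal vector fields $X\in H=\ker\eta$, $$R(x,y)\xi=-\eta(y)x+\eta(x)y,$$ $$[X,\xi]\in H,\qquad \nabla_\xi X=\phi X-[X,\xi]\in H,$$ $$R(\xi,X)\xi=X,\qquad Ric(y,\xi)=-2n\,\eta(y),\qquad Ric(\xi,\xi)=-2n.$$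
   Context: An almost paracontact paracomplex Riemannian manifold $(M,\phi,\xi,\eta,g)$ is a smooth manifold of dimension $2n+1$ with a $(1,1)$-tensor field $\phi$, a vector field $\xi$, a 1-form $\eta$ satisfying $\phi^2=\mathrm{id}-\eta\otimes\xi$, $\eta(\xi)=1$ (consequently $\phi\xi=0$, $\eta\circ\phi=0$), such that on $H=\ker\eta$ the eigenvalues $+1$ and $-1$ of $\phi|_H$ both have multiplicity $n$, and a Riemannian metric $g$ with $g(x,\xi)=\eta(x)$ and $g(\phi x,\phi y)=g(x,y)-\eta(x)\eta(y)$. With $\nabla$ the Levi-Civita connection of $g$ and $F(x,y,z)=g((\nabla_x\phi)y,z)$, it is called para-Sasaki-like if for all horizontal $X,Y,Z\in H$: $F(X,Y,Z)=F(\xi,Y,Z)=F(\xi,\xi,Z)=0$ and $F(X,Y,\xi)=-g(X,Y)$. Curvature conventions: $R(x,y)=[\nabla_x,\nabla_y]-\nabla_{[x,y]}$, $R(x,y,z,w)=g(R(x,y)z,w)$, $Ric(x,y)=\sum_{i=0}^{2n}R(e_i,x,y,e_i)$ for an orthonormal basis $\{e_0,\dots,e_{2n}\}$ of the tangent space. *)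

(* Defs.v *)
From HB Require Import structures.
From mathcomp Require Import all_boot all_order all_algebra.
From mathcomp Require Import all_classical all_reals all_analysis.
From mathcomp Require Import ring.

Set Implicit Arguments.
Unset Strict Implicit.
Unset Printing Implicit Defensive.

Import Order.TTheory GRing.Theory Num.Theory.
Import numFieldNormedType.Exports.

Local Open Scope classical_set_scope.
Local Open Scope ring_scope.

Section SmoothOn.
Variables (R : realType) (m : nat).
Implicit Types (U : set 'rV[R]_m) (f g : 'rV[R]_m -> R).

(* For U open: all iterated partial derivatives of f of order at most k exist
   and are continuous on U. *)
Fixpoint Ck_on (k : nat) U f : Prop :=
  {in U, continuous f} /\
  if k is k'.+1 then
    forall i : 'I_m, (forall x, U x -> derivable f x (delta_mx 0 i)) /\
                     Ck_on k' U ('D_(delta_mx 0 i) f)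
  else True.

Definition smooth_on U f := forall k, Ck_on k U f.

Lemma Ck_on_eq k U f g : open U -> (forall x, U x -> f x = g x) ->
  Ck_on k U f -> Ck_on k U g.
Proof.
move=> oU.
have nE (f' g' : 'rV[R]_m -> R) (e : forall x, U x -> f' x = g' x) x :
    U x -> \forall y \near x, f' y = g' y.
  by move=> Ux; apply: filterS (open_nbhs_nbhs (conj oU Ux)) => y /e.
have nC (f' g' : 'rV[R]_m -> R) (e : forall x, U x -> f' x = g' x) :
    {in U, continuous f'} -> {in U, continuous g'}.
  move=> cf x xU; have Ux : U x by rewrite inE in xU.
  have := cf x xU; rewrite /continuous_at (e _ Ux); apply: cvg_trans.
  exact: (near_eq_cvg (nE _ _ e x Ux)).
elim: k f g => [|k IH] f g e /= [cf H]; split => //; try exact: nC cf.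
move=> i; have [df Hf] := H i; split.
  by move=> x Ux; exact: (near_eq_derivable (nE _ _ e x Ux) (df x Ux)).
by apply: IH Hf => x Ux; apply: near_eq_derive; exact: nE.
Qed.

Lemma Ck_on_cst k U (a : R) : Ck_on k U (cst a).
Proof.
elim: k a => [|k IH] a /=; split => //; try by move=> x _; exact: cst_continuous.
move=> i; split => [x _|]; first exact: derivable_cst.
have -> : 'D_(delta_mx 0 i) (cst a) = cst 0 :> ('rV[R]_m -> R).
  by apply/funext => x; rewrite derive_cst.
exact: IH.
Qed.

Lemma Ck_on_pred k U f : Ck_on k.+1 U f -> Ck_on k U f.
Proof.
elim: k f => [|k IH] f [cf H]; split => //.
by move=> i; have [df /IH Hf] := H i; split.
Qed.

Lemma Ck_onD k U f g : open U -> Ck_on k U f -> Ck_on k U g ->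
  Ck_on k U (f + g).
Proof.
move=> oU; elim: k f g => [|k IH] f g /= [cf Hf] [cg Hg]; split => //;
  try by move=> x Ux; apply: continuousD; [exact: cf | exact: cg].
move=> i; have [df Hf'] := Hf i; have [dg Hg'] := Hg i; split.
  by move=> x Ux; apply: derivableD; [exact: df | exact: dg].
apply: Ck_on_eq (IH _ _ Hf' Hg') => // x Ux.
by rewrite deriveD //; [exact: df | exact: dg].
Qed.

Lemma Ck_onM k U f g : open U -> Ck_on k U f -> Ck_on k U g ->
  Ck_on k U (f * g).
Proof.
move=> oU; elim: k f g => [|k IH] f g Hf0 Hg0;
  have [cf Hf] := Hf0; have [cg Hg] := Hg0; split => //;
  try by move=> x Ux; apply: continuousM; [exact: cf | exact: cg].
move=> i; have [df Hf'] := Hf i; have [dg Hg'] := Hg i; split.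
  by move=> x Ux; apply: derivableM; [exact: df | exact: dg].
apply: Ck_on_eq (Ck_onD oU (IH _ _ (Ck_on_pred Hf0) Hg')
                           (IH _ _ (Ck_on_pred Hg0) Hf')) => // x Ux.
by rewrite deriveM //; [exact: df | exact: dg].
Qed.

End SmoothOn.

Record chart (R : realType) (m : nat) (M : topologicalType) := Chart {
  cdom : set M;
  cmap : M -> 'rV[R]_m;
  cinv : 'rV[R]_m -> M;
  cdom_open : open cdom;
  cimg_open : open (cmap @` cdom);
  cmapK : {in cdom, cancel cmap cinv};
  cmap_continuous : {in cdom, continuous cmap};
  cinv_continuous : {in cmap @` cdom, continuous cinv} }.

Record smooth_manifold (R : realType) (m : nat) := SmoothManifold {
  carrier :> topologicalType;
  carrier_hausdorff : hausdorff_space carrier;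
  carrier_second_countable : @second_countable carrier;
  atlas : set (chart R m carrier);
  atlas_cover : forall p, exists2 c, atlas c & cdom c p;
  atlas_compatible : forall c d, atlas c -> atlas d -> forall j : 'I_m,
    smooth_on (cmap c @` (cdom c `&` cdom d))
              (fun x => cmap d (cinv c x) 0 j) }.

Section SmoothFunctions.
Variables (R : realType) (m : nat) (M : smooth_manifold R m).

Definition smooth : {pred M -> R} := fun f => `[< forall c, atlas c ->
  smooth_on (cmap c @` cdom c) (f \o cinv c) >].

Lemma smooth_subring_closed : subring_closed smooth.
Proof.
have scst (a : R) : cst a \in smooth by apply/asboolP => c _ k; exact: Ck_on_cst.
have sM : {in smooth &, forall f g, f * g \in smooth}.
  move=> f g /asboolP sf /asboolP sg; apply/asboolP => c ac k.
  exact: Ck_onM (@cimg_open _ _ _ c) (sf c ac k) (sg c ac k).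
split => //; first exact: (scst 1).
move=> f g sf sg; have /asboolP sg' := sM _ _ (scst (-1)) sg.
move/asboolP: sf => sf; apply/asboolP => c ac k.
apply: Ck_on_eq (Ck_onD (@cimg_open _ _ _ c) (sf c ac k) (sg' c ac k)) => //.
  exact: cimg_open.
by move=> x _ /=; rewrite [LHS]/(_ + -1 * _) mulN1r.
Qed.

Record Cinf := MkCinf { cfun :> M -> R; cfunP : cfun \in smooth }.
HB.instance Definition _ := [isSub for cfun].
HB.instance Definition _ := [Choice of Cinf by <:].
HB.instance Definition _ :=
  GRing.SubChoice_isSubComPzRing.Build (M -> R) smooth Cinf smooth_subring_closed.

Lemma smooth_cst (a : R) : cst a \in smooth.
Proof. by apply/asboolP => c _ k; exact: Ck_on_cst. Qed.
Definition Ccst (a : R) : Cinf := MkCinf (smooth_cst a).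

Lemma CinfP (f g : Cinf) : (forall p, f p = g p) -> f = g.
Proof. by move=> e; apply: val_inj; apply/funext. Qed.

Lemma Cinf0E p : (0 : Cinf) p = 0. Proof. by []. Qed.
Lemma Cinf1E p : (1 : Cinf) p = 1. Proof. by []. Qed.
Lemma CinfDE (f g : Cinf) p : (f + g) p = f p + g p. Proof. by []. Qed.
Lemma CinfNE (f : Cinf) p : (- f) p = - f p. Proof. by []. Qed.
Lemma CinfME (f g : Cinf) p : (f * g) p = f p * g p. Proof. by []. Qed.

End SmoothFunctions.

Arguments smooth {R m M}.

Section TangentSpace.
Variables (R : realType) (m : nat) (M : smooth_manifold R m) (p : M).

Definition derivation_at : {pred (Cinf M -> R^o)} := fun v => `[<
  [/\ forall f g, v (f + g) = v f + v g,
      forall a f, v (Ccst M a * f) = a * v f &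
      forall f g, v (f * g) = f p * v g + g p * v f] >].

Lemma derivation_at_submod : submod_closed derivation_at.
Proof.
split.
  apply/asboolP; split => *; rewrite /= ?[(0 : _ -> _) _]/(0 : R);
  by rewrite ?addr0 ?mulr0 ?addr0.
move=> a v w /asboolP[vD vC vM] /asboolP[wD wC wM]; apply/asboolP.
have E f : (a *: v + w) f = a * v f + w f by [].
split => *; rewrite !E.
- by rewrite vD wD mulrDr addrACA.
- by rewrite vC wC mulrDr mulrCA.
- by rewrite vM wM !mulrDr addrACA !(mulrCA a).
Qed.

(* The tangent space at p: R-linear derivations at p of the ring of smooth
   functions. *)
Record tangent := MkTangent {
  tval :> Cinf M -> R^o; tvalP : tval \in derivation_at }.
HB.instance Definition _ := [isSub for tval].
HB.instance Definition _ := [Choice of tangent by <:].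
HB.instance Definition _ := GRing.SubChoice_isSubLmodule.Build R
  (Cinf M -> R^o) derivation_at tangent derivation_at_submod.

End TangentSpace.

Lemma tangentP (R : realType) (m : nat) (M : smooth_manifold R m) (p : M)
  (u v : tangent p) : (forall f, u f = v f) -> u = v.
Proof. by move=> e; apply: val_inj; apply/funext. Qed.

Section VectorFields.
Variables (R : realType) (m : nat) (M : smooth_manifold R m).

Definition smooth_section (X : forall p : M, tangent p) :=
  forall f : Cinf M, (fun p => X p f) \in smooth.

Record vfield := MkVfield {
  vfield_at :> forall p : M, tangent p;
  vfieldP : smooth_section vfield_at }.

Lemma vfield_eq (X Y : vfield) : (forall p, X p = Y p) -> X = Y.
Proof.
case: X Y => [X sX] [Y sY] /= e.
have eXY : X = Y by apply: functional_extensionality_dep.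
by subst Y; rewrite (Prop_irrelevance sX sY).
Qed.

HB.instance Definition _ := gen_eqMixin vfield.
HB.instance Definition _ := gen_choiceMixin vfield.

Definition vact (X : vfield) (f : Cinf M) : Cinf M := MkCinf (vfieldP X f).

Lemma vfield0_smooth : smooth_section (fun p => 0).
Proof. by move=> f; exact: (cfunP 0). Qed.
Lemma vfieldD_smooth (X Y : vfield) : smooth_section (fun p => X p + Y p).
Proof. by move=> f; exact: (cfunP (vact X f + vact Y f)). Qed.
Lemma vfieldN_smooth (X : vfield) : smooth_section (fun p => - X p).
Proof. by move=> f; exact: (cfunP (- vact X f)). Qed.
Lemma vfieldZ_smooth (h : Cinf M) (X : vfield) :
  smooth_section (fun p => h p *: X p).
Proof. by move=> f; exact: (cfunP (h * vact X f)). Qed.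

Definition vfield0 := MkVfield vfield0_smooth.
Definition vfieldD X Y := MkVfield (vfieldD_smooth X Y).
Definition vfieldN X := MkVfield (vfieldN_smooth X).
Definition vfieldZ h X := MkVfield (vfieldZ_smooth h X).

Lemma vfieldDA : associative vfieldD.
Proof. by move=> X Y Z; apply: vfield_eq => p; exact: addrA. Qed.
Lemma vfieldDC : commutative vfieldD.
Proof. by move=> X Y; apply: vfield_eq => p; exact: addrC. Qed.
Lemma vfield0D : left_id vfield0 vfieldD.
Proof. by move=> X; apply: vfield_eq => p; exact: add0r. Qed.
Lemma vfieldND : left_inverse vfield0 vfieldN vfieldD.
Proof. by move=> X; apply: vfield_eq => p; exact: addNr. Qed.

HB.instance Definition _ :=
  GRing.isZmodule.Build vfield vfieldDA vfieldDC vfield0D vfieldND.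

Lemma vfieldZA f g X : vfieldZ f (vfieldZ g X) = vfieldZ (f * g) X.
Proof. by apply: vfield_eq => p; exact: scalerA. Qed.
Lemma vfield1Z : left_id 1 vfieldZ.
Proof. by move=> X; apply: vfield_eq => p; exact: scale1r. Qed.
Lemma vfieldZDr : right_distributive vfieldZ +%R.
Proof. by move=> f X Y; apply: vfield_eq => p; exact: scalerDr. Qed.
Lemma vfieldZDl X : {morph vfieldZ^~ X : f g / f + g}.
Proof. by move=> f g; apply: vfield_eq => p; exact: scalerDl. Qed.

HB.instance Definition _ := GRing.Zmodule_isLmodule.Build (Cinf M) vfield
  vfieldZA vfield1Z vfieldZDr vfieldZDl.

Lemma vactD (X : vfield) f g : vact X (f + g) = vact X f + vact X g.
Proof. by apply: CinfP => p; have /asboolP[+ _ _] := tvalP (X p); apply. Qed.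
Lemma vactC (X : vfield) a f : vact X (Ccst M a * f) = Ccst M a * vact X f.
Proof. by apply: CinfP => p; have /asboolP[_ + _] := tvalP (X p); apply. Qed.
Lemma vactM (X : vfield) f g : vact X (f * g) = f * vact X g + g * vact X f.
Proof. by apply: CinfP => p; have /asboolP[_ _ +] := tvalP (X p); apply. Qed.

Lemma lie_derivation (X Y : vfield) (p : M) :
  (fun f => X p (vact Y f) - Y p (vact X f)) \in @derivation_at R m M p.
Proof.
apply/asboolP; have /asboolP[XD XC XM] := tvalP (X p).
have /asboolP[YD YC YM] := tvalP (Y p); split => [f g|a f|f g].
- by rewrite !vactD XD YD opprD addrACA.
- by rewrite !vactC XC YC mulrBr.
rewrite !vactM XD YD !XM !YM !mulrBr /=.
set a := Y p f; set b := Y p g; set c := X p f; set d := X p g.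
set a' := X p (vact Y g); set b' := X p (vact Y f).
set c' := Y p (vact X g); set d' := Y p (vact X f).
ring.
Qed.

Definition lie_at (X Y : vfield) (p : M) : tangent p :=
  MkTangent (lie_derivation X Y p).

Lemma lie_smooth (X Y : vfield) : smooth_section (lie_at X Y).
Proof.
by move=> f; exact: (cfunP (vact X (vact Y f) - vact Y (vact X f))).
Qed.

Definition lie (X Y : vfield) : vfield := MkVfield (lie_smooth X Y).

End VectorFields.

Section TensorFields.
Variables (R : realType) (m : nat) (M : smooth_manifold R m).

(* A tensor field is a family of multilinear maps on the tangent spaces; it is
   smooth iff its values on smooth vector fields are. *)

Record endo_field := EndoField {
  endo_at :> forall p : M, {linear tangent p -> tangent p};
  endo_smooth : forall X : vfield M, smooth_section (fun p => endo_at p (X p)) }.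

Record one_form := OneForm {
  form_at :> forall p : M, {linear tangent p -> R^o};
  form_smooth : forall X : vfield M, (fun p => form_at p (X p)) \in smooth }.

Record riemannian_metric := RiemannianMetric {
  metric_at :> forall p : M, tangent p -> tangent p -> R;
  metric_linear : forall p (a : R) (u v w : tangent p),
    metric_at (a *: u + v) w = a * metric_at u w + metric_at v w;
  metric_sym : forall p (u v : tangent p), metric_at u v = metric_at v u;
  metric_pos : forall p (u : tangent p), u != 0 -> 0 < metric_at u u;
  metric_smooth : forall X Y : vfield M,
    (fun p => metric_at (X p) (Y p)) \in smooth }.

Definition eapp (phi : endo_field) (X : vfield M) : vfield M :=
  MkVfield (endo_smooth phi X).
Definition fapp (eta : one_form) (X : vfield M) : Cinf M :=
  MkCinf (form_smooth eta X).
Definition gapp (g : riemannian_metric) (X Y : vfield M) : Cinf M :=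
  MkCinf (metric_smooth g X Y).

Record connection := Connection {
  nabla :> vfield M -> vfield M -> vfield M;
  nabla_linear : forall (f : Cinf M) X X' Y,
    nabla (f *: X + X') Y = f *: nabla X Y + nabla X' Y;
  nabla_additive : forall X Y Y', nabla X (Y + Y') = nabla X Y + nabla X Y';
  nabla_leibniz : forall X (f : Cinf M) Y,
    nabla X (f *: Y) = vact X f *: Y + f *: nabla X Y }.

Definition levi_civita (g : riemannian_metric) (D : connection) :=
  (forall X Y, D X Y - D Y X = lie X Y) /\
  (forall X Y Z, vact X (gapp g Y Z) = gapp g (D X Y) Z + gapp g Y (D X Z)).

Definition curv (D : connection) (x y z : vfield M) : vfield M :=
  D x (D y z) - D y (D x z) - D (lie x y) z.

Definition curv4 (g : riemannian_metric) (D : connection)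
    (x y z w : vfield M) : Cinf M :=
  gapp g (curv D x y z) w.

End TensorFields.

Definition basis_of_set (R : realType) (V : lmodType R) (W : set V) (k : nat)
    (b : 'I_k -> V) :=
  (forall i, W (b i)) /\
  forall v, W v -> exists! c : 'rV[R]_k, v = \sum_i c 0 i *: b i.

Definition has_dim (R : realType) (V : lmodType R) (W : set V) (k : nat) :=
  exists b : 'I_k -> V, basis_of_set W b.

Section Ricci.
Variables (R : realType) (m : nat) (M : smooth_manifold R m).
Variables (g : riemannian_metric M) (D : connection M).

Definition orthonormal_basis_at (p : M) (e : 'I_m -> tangent p) :=
  basis_of_set [set: tangent p] e /\
  forall i j, g p (e i) (e j) = (i == j)%:R.

(* Ric(x, y) = \sum_i R(e_i, x, y, e_i), with (e_i) an orthonormal basis of the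
   tangent space at p.  The value of the curvature on tangent vectors is taken
   on vector fields extending them, as the latter is tensorial. *)
Definition is_ricci (Ric : vfield M -> vfield M -> Cinf M) :=
  forall (x y : vfield M) (p : M),
  exists2 E : 'I_m -> vfield M, orthonormal_basis_at (fun i => E i p) &
    Ric x y p = \sum_i curv4 g D (E i) x y (E i) p.

End Ricci.

(* Almost paracontact paracomplex Riemannian structures.  As phi squares to the
   identity on ker eta, it is diagonalizable there, so that the multiplicity of
   an eigenvalue is the dimension of its eigenspace. *)
Record apcpc_structure (R : realType) (n : nat)
    (M : smooth_manifold R (2 * n).+1) := ApcpcStructure {
  phi : endo_field M;
  xi : vfield M;
  eta : one_form M;
  met : riemannian_metric M;
  phi_sqr : forall p (u : tangent p),
    phi p (phi p u) = u - (eta p u : R) *: xi p;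
  eta_xi : forall p, eta p (xi p) = 1;
  phi_eigen1 : forall p,
    has_dim [set u : tangent p | eta p u = 0 /\ phi p u = u] n;
  phi_eigenN1 : forall p,
    has_dim [set u : tangent p | eta p u = 0 /\ phi p u = - u] n;
  met_xi : forall p (u : tangent p), met p u (xi p) = eta p u;
  met_phi : forall p (u v : tangent p),
    met p (phi p u) (phi p v) = met p u v - eta p u * eta p v }.

Section ParaSasakiLike.
Variables (R : realType) (n : nat) (M : smooth_manifold R (2 * n).+1).
Variables (S : apcpc_structure M) (D : connection M).

Definition horizontal (X : vfield M) := fapp (eta S) X = 0.

(* (nabla_x phi) y *)
Definition nabla_phi (x y : vfield M) : vfield M :=
  D x (eapp (phi S) y) - eapp (phi S) (D x y).

Definition Ften (x y z : vfield M) : Cinf M := gapp (met S) (nabla_phi x y) z.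

Definition para_sasaki_like :=
  forall X Y Z, horizontal X -> horizontal Y -> horizontal Z ->
  [/\ Ften X Y Z = 0, Ften (xi S) Y Z = 0, Ften (xi S) (xi S) Z = 0 &
      Ften X Y (xi S) = - gapp (met S) X Y].

End ParaSasakiLike.

(* Main.v *)
Require Import Defs.
From mathcomp Require Import all_boot all_order all_algebra.
From mathcomp Require Import all_classical all_reals all_analysis.
From mathcomp Require Import ring.

Import Order.TTheory GRing.Theory Num.Theory.
Import numFieldNormedType.Exports.

Local Open Scope ring_scope.

(** Write h for eta and P(x,y) for (nabla_x phi) y.  Everything follows from a
    closed form of P, purely algebraic in g, h and xi ([nabla_phiE]):
      P(x,y) = - g(x,y) xi - h(y) x + 2 h(x) h(y) xi.
    To obtain it, note that phi is self-adjoint, so the tensor F(x,y,z), which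
    is g(P(x,y), z), is symmetric in y and z.  Splitting each argument into a
    horizontal part and a multiple of xi, the para-Sasaki-like conditions then
    determine all the components of F, except F(x,xi,xi), which vanishes since
    phi takes values in the kernel of h.

    Taking y = xi gives phi (nabla_x xi) = x - h(x) xi; as xi has unit length,
    nabla_x xi is horizontal, whence nabla_x xi = phi x ([nabla_xiE]).  In
    particular the derivative of h is again algebraic, nabla being metric.

    Since nabla has no torsion, R(x,y) xi is P(x,y) - P(y,x)
    ([curv_xiE]); its trace is Ric(y,xi), by Parseval's identity in an
    orthonormal frame ([ricci_xiE]).  The same commutation applied to phi z
    instead of xi is the Ricci identity for phi: R(x,y) phi z - phi R(x,y) z is
    the skew-symmetrization in x, y of the covariant derivative of P, which is
    computed from the closed form and the derivative of h ([curv4_phi]).  The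
    statements on [X, xi] and nabla_xi X come from nabla_X xi = phi X and from
    differentiating h(X) = 0 along xi. *)

(** * Vector fields acting on functions *)

Section VectorFieldAction.
Context {R : realType} {m : nat} {M : smooth_manifold R m}.
Implicit Types (x : vfield M) (f : Cinf M).

Lemma vact0 x : vact x 0 = 0.
Proof. by apply: (addrI (vact x 0)); rewrite -vactD !addr0. Qed.

Lemma vactN x f : vact x (- f) = - vact x f.
Proof. by apply: (addrI (vact x f)); rewrite -vactD !subrr vact0. Qed.

Lemma vact_double x f : vact x (2 * f) = 2 * vact x f.
Proof. by rewrite !mulr_natl !mulr2n vactD. Qed.

Lemma vact1 x : vact x 1 = 0.
Proof. by apply: (addrI (vact x 1)); rewrite -{3}[1]mul1r vactM !mul1r addr0. Qed.

Lemma double_eq0 f : f + f = 0 -> f = 0.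
Proof.
move=> f0; apply: CinfP => p; apply/eqP.
by have := congr1 (fun k : Cinf M => k p) f0; rewrite CinfDE -mulr2n => /eqP;
  rewrite mulrn_eq0.
Qed.

Lemma Cinf_mulrnE f k p : (f *+ k) p = f p *+ k.
Proof. by elim: k => [|k IH]; rewrite ?mulr0n // !mulrS CinfDE IH. Qed.

End VectorFieldAction.

(** * Metrics and connections over the ring of smooth functions *)

Section Metric.
Context {R : realType} {m : nat} {M : smooth_manifold R m}.
Variable g : riemannian_metric M.
Implicit Types (x y z : vfield M) (f : Cinf M).

Lemma gappC x y : gapp g x y = gapp g y x.
Proof. by apply: CinfP => p; exact: Defs.metric_sym. Qed.

Lemma gappDl x y z : gapp g (x + y) z = gapp g x z + gapp g y z.
Proof.
apply: CinfP => p; have := metric_linear g 1 (x p) (y p) (z p).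
by rewrite scale1r mul1r.
Qed.

Lemma gapp0l z : gapp g 0 z = 0.
Proof. by apply: (addrI (gapp g 0 z)); rewrite -gappDl !addr0. Qed.

Lemma gappZl f x z : gapp g (f *: x) z = f * gapp g x z.
Proof.
apply: CinfP => p; have := metric_linear g (f p) (x p) 0 (z p).
have := congr1 (fun k : Cinf M => k p) (gapp0l z); rewrite /= => ->.
by rewrite !addr0.
Qed.

Lemma gappNl x z : gapp g (- x) z = - gapp g x z.
Proof. by rewrite -scaleN1r gappZl mulN1r. Qed.

Lemma gappDr z x y : gapp g z (x + y) = gapp g z x + gapp g z y.
Proof. by rewrite 3!(gappC z) gappDl. Qed.

Lemma gappZr f z x : gapp g z (f *: x) = f * gapp g z x.
Proof. by rewrite 2!(gappC z) gappZl. Qed.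

Lemma gappNr z x : gapp g z (- x) = - gapp g z x.
Proof. by rewrite 2!(gappC z) gappNl. Qed.

Definition gapp_lin :=
  (gapp0l, gappDl, gappDr, gappNl, gappNr, gappZl, gappZr).

Lemma gapp_eq0 x : gapp g x x = 0 -> x = 0.
Proof.
move=> gx0; apply: vfield_eq => p; apply/eqP/negPn/negP => /(metric_pos g).
by have := congr1 (fun k : Cinf M => k p) gx0; rewrite /= => ->; rewrite ltxx.
Qed.

(** Pairing with an arbitrary field turns identities between vector fields into
    polynomial identities between functions. *)
Lemma gapp_inj x y : (forall z, gapp g x z = gapp g y z) -> x = y.
Proof.
move=> e; apply/eqP; rewrite -subr_eq0; apply/eqP/gapp_eq0.
by rewrite gappDl gappNl e subrr.
Qed.

Lemma metric_sum p k (c : 'I_k -> R) (e : 'I_k -> tangent p) v :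
  g p (\sum_i c i *: e i) v = \sum_i c i * g p (e i) v.
Proof.
have g0 : g p 0 v = 0.
  apply: (addrI (g p 0 v)); have := metric_linear g 1 0 0 v.
  by rewrite scale1r mul1r !addr0.
by elim/big_rec2: _ => // i a u _ <-; rewrite metric_linear.
Qed.

Lemma orthonormal_parseval p (e : 'I_m -> tangent p) u v :
  orthonormal_basis_at g e -> \sum_i g p u (e i) * g p v (e i) = g p u v.
Proof.
move=> [[_ /(_ u I) [c [-> _]]] eE]; rewrite metric_sum; apply: eq_bigr => i _.
rewrite metric_sum (bigD1 i) //= eE eqxx mulr1 big1 => [|j ji].
  by rewrite addr0 (Defs.metric_sym g v).
by rewrite eE (negPf ji) mulr0.
Qed.

End Metric.

Section Connection.
Context {R : realType} {m : nat} {M : smooth_manifold R m}.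
Variable D : connection M.
Implicit Types (x y z : vfield M) (f : Cinf M).

Lemma nablaDl x y z : D (x + y) z = D x z + D y z.
Proof. by have := nabla_linear D 1 x y z; rewrite !scale1r. Qed.

Lemma nabla0l z : D 0 z = 0.
Proof. by apply: (addrI (D 0 z)); rewrite -nablaDl !addr0. Qed.

Lemma nablaZl f x z : D (f *: x) z = f *: D x z.
Proof. by have := nabla_linear D f x 0 z; rewrite nabla0l !addr0. Qed.

Lemma nabla0r x : D x 0 = 0.
Proof. by apply: (addrI (D x 0)); rewrite -nabla_additive !addr0. Qed.

Lemma nablaNr x y : D x (- y) = - D x y.
Proof. by apply: (addrI (D x y)); rewrite -nabla_additive !subrr nabla0r. Qed.

End Connection.

(** * Almost paracontact paracomplex Riemannian structures *)

Section Structure.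
Context {R : realType} {n : nat} {M : smooth_manifold R (2 * n).+1}.
Variable S : apcpc_structure M.
Implicit Types (x y z : vfield M) (f : Cinf M).

Local Notation g := (gapp (met S)).
Local Notation h := (fapp (eta S)).
Local Notation ph := (eapp (phi S)).
Local Notation xi0 := (xi S).

Lemma phiD x y : ph (x + y) = ph x + ph y.
Proof. by apply: vfield_eq => p; exact: linearD. Qed.

Lemma phiN x : ph (- x) = - ph x.
Proof. by apply: vfield_eq => p; exact: linearN. Qed.

Lemma phiZ f x : ph (f *: x) = f *: ph x.
Proof. by apply: vfield_eq => p; exact: linearZ. Qed.

Lemma phi_phi x : ph (ph x) = x - h x *: xi0.
Proof. by apply: vfield_eq => p; exact: phi_sqr. Qed.

Lemma gapp_xir x : g x xi0 = h x.
Proof. by apply: CinfP => p; exact: met_xi. Qed.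

Lemma gapp_xil x : g xi0 x = h x.
Proof. by rewrite gappC; exact: gapp_xir. Qed.

Lemma eta_xi1 : h xi0 = 1.
Proof. by apply: CinfP => p; exact: eta_xi. Qed.

Lemma gapp_phi_phi x y : g (ph x) (ph y) = g x y - h x * h y.
Proof. by apply: CinfP => p; exact: met_phi. Qed.

Lemma phi_xi : ph xi0 = 0.
Proof.
by apply: (gapp_eq0 (met S)); rewrite gapp_phi_phi gapp_xir eta_xi1 mulr1 subrr.
Qed.

(** Squaring phi first or last gives two values of its cube on x, whose
    difference is h(phi x) xi. *)
Lemma eta_phi x : h (ph x) = 0.
Proof.
have := congr1 ph (phi_phi x); rewrite phi_phi phiD phiN phiZ phi_xi scaler0.
move/addrI/(congr1 (fun y => g y xi0)); rewrite !gapp_lin gapp_xir eta_xi1.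
by rewrite mulr1 oppr0 => /eqP; rewrite oppr_eq0 => /eqP.
Qed.

(** Since phi is an involution up to xi and an isometry up to eta, it is
    self-adjoint. *)
Lemma gapp_phil x y : g (ph x) y = g x (ph y).
Proof.
have := gapp_phi_phi x (ph y); rewrite eta_phi mulr0 subr0 phi_phi => <-.
by rewrite gapp_lin gappNr gappZr gapp_xir eta_phi mulr0 subr0.
Qed.

Lemma gapp_phiC x y : g x (ph y) = g y (ph x).
Proof. by rewrite -gapp_phil gappC. Qed.

Lemma fappD x y : h (x + y) = h x + h y.
Proof. by rewrite -!gapp_xir gappDl. Qed.

Lemma fappN x : h (- x) = - h x.
Proof. by rewrite -!gapp_xir gappNl. Qed.

Lemma fappZ f x : h (f *: x) = f * h x.
Proof. by rewrite -!gapp_xir gappZl. Qed.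

(** * The covariant derivative of phi *)

Variable D : connection M.
Hypothesis HLC : levi_civita (met S) D.

Local Notation P := (nabla_phi S D).
Local Notation F := (Ften S D).

Lemma nabla_phiK x y : D x (ph y) = ph (D x y) + P x y.
Proof. by rewrite /nabla_phi addrC subrK. Qed.

Lemma nabla_phiDl x y z : P (x + y) z = P x z + P y z.
Proof. by rewrite /nabla_phi !nablaDl phiD opprD addrACA. Qed.

Lemma nabla_phiZl f x z : P (f *: x) z = f *: P x z.
Proof. by rewrite /nabla_phi !nablaZl phiZ scalerBr. Qed.

Lemma nabla_phiDr z x y : P z (x + y) = P z x + P z y.
Proof. by rewrite /nabla_phi phiD !nabla_additive phiD opprD addrACA. Qed.

Lemma nabla_phiZr f z x : P z (f *: x) = f *: P z x.
Proof.
rewrite /nabla_phi phiZ !nabla_leibniz phiD !phiZ scalerBr opprD addrACA.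
by rewrite subrr add0r.
Qed.

Lemma vact_gapp x y z : vact x (g y z) = g (D x y) z + g y (D x z).
Proof. exact: HLC.2. Qed.

(** The derivative of a self-adjoint field of endomorphisms is self-adjoint. *)
Lemma FtenC x y z : F x y z = F x z y.
Proof.
have e := congr1 (vact x) (gapp_phil y z); rewrite !vact_gapp in e.
rewrite /Ften /nabla_phi !gapp_lin !gapp_phil.
rewrite (_ : g (D x (ph z)) y = g y (D x (ph z))); last exact: gappC.
rewrite (_ : g (D x z) (ph y) = g (ph y) (D x z)); last exact: gappC.
have -> : g (D x (ph y)) z = g (D x y) (ph z) + g y (D x (ph z))
   - g (ph y) (D x z) by rewrite -e addrK.
ring.
Qed.

(** The field xi has constant length, so its derivatives are orthogonal to it. *)
Lemma eta_nabla_xi x : h (D x xi0) = 0.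
Proof.
apply: double_eq0; rewrite -{1}gapp_xir -gapp_xil -vact_gapp.
by rewrite gapp_xir eta_xi1 vact1.
Qed.

Lemma nabla_phi_xi x : P x xi0 = - ph (D x xi0).
Proof. by rewrite /nabla_phi phi_xi nabla0r add0r. Qed.

Lemma Ften_xi_xi x : F x xi0 xi0 = 0.
Proof. by rewrite /Ften nabla_phi_xi gapp_xir fappN eta_phi oppr0. Qed.

Lemma FtenDl x y z w : F (x + y) z w = F x z w + F y z w.
Proof. by rewrite /Ften nabla_phiDl gappDl. Qed.

Lemma FtenDm x y z w : F x (y + z) w = F x y w + F x z w.
Proof. by rewrite /Ften nabla_phiDr gappDl. Qed.

Lemma FtenDr x y z w : F x y (z + w) = F x y z + F x y w.
Proof. by rewrite /Ften gappDr. Qed.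

Lemma FtenZl f x y z : F (f *: x) y z = f * F x y z.
Proof. by rewrite /Ften nabla_phiZl gappZl. Qed.

Lemma FtenZm f x y z : F x (f *: y) z = f * F x y z.
Proof. by rewrite /Ften nabla_phiZr gappZl. Qed.

Lemma FtenZr f x y z : F x y (f *: z) = f * F x y z.
Proof. by rewrite /Ften gappZr. Qed.

(** The vectors are kept arbitrary here, the horizontal parts being themselves
    differences that the additivity rules would split. *)
Lemma Ften_split x y z u a b c :
  F (x + a *: u) (y + b *: u) (z + c *: u) =
    F x y z + c * F x y u + b * F x u z + b * c * F x u u
    + a * (F u y z + c * F u y u + b * F u u z + b * c * F u u u).
Proof.
rewrite !(FtenDl, FtenZl) !(FtenDm, FtenZm) !(FtenDr, FtenZr); ring.
Qed.

Hypothesis HPS : para_sasaki_like S D.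

Definition hor x := x - h x *: xi0.

Lemma horizontal_hor x : horizontal S (hor x).
Proof. by rewrite /horizontal fappD fappN fappZ eta_xi1 mulr1 subrr. Qed.

Lemma horK x : x = hor x + h x *: xi0.
Proof. by rewrite /hor subrK. Qed.

Lemma gapp_hor x y : g (hor x) (hor y) = g x y - h x * h y.
Proof.
rewrite /hor !gapp_lin !gapp_xir !gapp_xil eta_xi1; ring.
Qed.

(** Splitting each argument into its horizontal part and a multiple of xi, the
    defining conditions leave only the components of F in which the last two
    arguments are horizontal and xi, in either order, with a horizontal first
    argument. *)
Lemma FtenE x y z :
  F x y z = - h z * (g x y - h x * h y) - h y * (g x z - h x * h z).
Proof.
have [[Hx Hy] Hz] := (horizontal_hor x, horizontal_hor y, horizontal_hor z).
have [Fxyz Fxiyz Fxixiz Fxyxi] := HPS _ _ _ Hx Hy Hz.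
have [_ _ Fxixiy Fxzxi] := HPS _ _ _ Hx Hz Hy.
rewrite {1}(horK x) {1}(horK y) {1}(horK z) Ften_split.
rewrite (FtenC (hor x) xi0 (hor z)) (FtenC xi0 (hor y) xi0) !Ften_xi_xi.
rewrite Fxyz Fxiyz Fxixiz Fxixiy Fxyxi Fxzxi !gapp_hor; ring.
Qed.

Lemma nabla_phiE x y :
  P x y = (- g x y + 2 * (h x * h y)) *: xi0 - h y *: x.
Proof.
apply: (gapp_inj (met S)) => z; rewrite (_ : g (P x y) z = F x y z) //.
rewrite FtenE !gapp_lin gapp_xil; ring.
Qed.

(** At y = xi the closed form computes phi (nabla_x xi); on the horizontal
    field nabla_x xi, phi is inverted by phi. *)
Lemma nabla_xiE x : D x xi0 = ph x.
Proof.
have := nabla_phi_xi x; rewrite nabla_phiE => /(congr1 ph).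
rewrite phiN phi_phi eta_nabla_xi scale0r subr0 phiD phiN !phiZ phi_xi scaler0.
by rewrite eta_xi1 scale1r add0r => /oppr_inj.
Qed.

(** The covariant derivative of eta is the symmetric form g(x, phi y), hence eta
    is closed. *)
Lemma vact_eta x y : vact x (h y) = h (D x y) + g x (ph y).
Proof. by rewrite -!gapp_xir vact_gapp nabla_xiE (gapp_phiC y). Qed.

(** * Curvature *)

(** As nabla xi is phi and nabla has no torsion, the curvature on xi is the
    skew-symmetrization of the covariant derivative of phi, in which the terms
    along xi cancel. *)
Lemma curv_xiE x y : curv D x y xi0 = - h y *: x + h x *: y.
Proof.
rewrite /curv !nabla_xiE -HLC.1 !nabla_phiK phiD phiN.
rewrite !nabla_phiE; apply: (gapp_inj (met S)) => z.
rewrite !gapp_lin (_ : g y x = g x y); last exact: gappC.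
ring.
Qed.

(** The Ricci identity for phi: the commutator of the curvature with phi is the
    skew-symmetrized second covariant derivative of phi, which the closed form
    of the first one makes algebraic. *)
Lemma curv4_phi x y z w :
  curv4 (met S) D x y (ph z) w - curv4 (met S) D x y z (ph w) =
    - (g y z - 2 * h y * h z) * g x (ph w)
    - (g y w - 2 * h y * h w) * g x (ph z)
    + (g x z - 2 * h x * h z) * g y (ph w)
    + (g x w - 2 * h x * h w) * g y (ph z).
Proof.
rewrite /curv4 /curv !nabla_phiK !nabla_phiE !nabla_additive !nablaNr.
rewrite !nabla_leibniz !nabla_phiK !nabla_phiE !nabla_xiE -!HLC.1.
rewrite !vactD !vactN !vact_double !vactM !vact_gapp !vact_eta.
rewrite !gapp_lin !gapp_phil !gapp_xil !fappD !fappN (gapp_phiC y x).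
ring.
Qed.

(** In the trace of the curvature on xi, each of the 2n+1 unit vectors of the
    frame contributes - eta y, and Parseval's identity returns one eta y. *)
Lemma ricci_xiE Ric y :
  is_ricci (met S) D Ric -> Ric y xi0 = - (2 * n)%:R * h y.
Proof.
move=> HRic; apply: CinfP => p; rewrite mulNr mulr_natl -mulNrn Cinf_mulrnE.
have [E oE ->] := HRic y xi0 p.
have term i : curv4 (met S) D (E i) y xi0 (E i) p =
    - h y p + met S p (xi0 p) (E i p) * met S p (y p) (E i p).
  have -> : curv4 (met S) D (E i) y xi0 (E i) =
      - h y * g (E i) (E i) + g xi0 (E i) * g y (E i).
    by rewrite /curv4 curv_xiE !gapp_lin gapp_xil.
  by rewrite CinfDE !CinfME /= oE.2 eqxx mulr1.
rewrite (eq_bigr _ (fun i _ => term i)) big_split /= orthonormal_parseval //.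
by rewrite Defs.metric_sym met_xi sumr_const card_ord mulrSr subrK.
Qed.

End Structure.

(** * Curvature of para-Sasaki-like manifolds *)

Theorem proposition3p1 (R : realType) (n : nat)
  (M : smooth_manifold R (2 * n).+1) (S : apcpc_structure M)
  (D : connection M) (HLC : levi_civita (met S) D)
  (HPS : para_sasaki_like S D)
  (Ric : vfield M -> vfield M -> Cinf M) (HRic : is_ricci (met S) D Ric) :
  let g := gapp (met S) in
  let h := fapp (eta S) in
  let ph := eapp (phi S) in
  let xi0 := xi S in
  let Rm := curv4 (met S) D in
  (forall x y z w : vfield M,
     Rm x y (ph z) w - Rm x y z (ph w) =
       - (g y z - 2 * h y * h z) * g x (ph w)
       - (g y w - 2 * h y * h w) * g x (ph z)
       + (g x z - 2 * h x * h z) * g y (ph w)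
       + (g x w - 2 * h x * h w) * g y (ph z)) /\
  (forall x y : vfield M, curv D x y xi0 = - h y *: x + h x *: y) /\
  (forall X : vfield M, horizontal S X ->
     [/\ horizontal S (lie X xi0),
         D xi0 X = ph X - lie X xi0,
         horizontal S (D xi0 X) &
         curv D xi0 X xi0 = X]) /\
  (forall y : vfield M, Ric y xi0 = - (2 * n)%:R * h y) /\
  Ric xi0 xi0 = - (2 * n)%:R.
Proof.
have Rxi := curv_xiE _ _ HLC HPS.
split; first exact: curv4_phi HLC HPS.
split; first exact: Rxi.
split; last first.
  split=> [y|]; first exact: (ricci_xiE _ _ HLC HPS).
  by rewrite (ricci_xiE _ _ HLC HPS) // eta_xi1 mulr1.
move=> X hX.
have Dxi : D (xi S) X = eapp (phi S) X - lie X (xi S).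
  by rewrite -HLC.1 (nabla_xiE _ _ HLC HPS) opprB addrC subrK.
have hD : horizontal S (D (xi S) X).
  have := vact_eta _ _ HLC HPS (xi S) X.
  by rewrite hX vact0 gapp_xil eta_phi addr0 => /esym.
split => //; last by rewrite Rxi hX oppr0 scale0r add0r eta_xi1 scale1r.
by move: hD; rewrite /horizontal Dxi fappD fappN eta_phi add0r => /eqP;
  rewrite oppr_eq0 => /eqP.
Qed.
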